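(* Let $\boldsymbol{X}=(\boldsymbol{X}_1,\dots,\boldsymbol{X}_{n_x})$ and $\boldsymbol{Y}=(\boldsymbol{Y}_1,\dots,\boldsymbol{Y}_{n_y})$ be two given samples, let $\mathbf{t}$ be the $\mathbb{R}^k$-valued sufficient statistic, and let $\bar{\boldsymbol{t}}^x=\frac{1}{n_x}\sum_{i=1}^{n_x}\mathbf{t}(\boldsymbol{X}_i)\in\mathbb{R}^k$ and $\boldsymbol{C}^y=\operatorname{conv}\{\mathbf{t}(\boldsymbol{Y}_j): j=1,\dots,n_y\}\subset\mathbb{R}^k$. Let $\ell_{\mathrm{KL}}:\mathbb{R}^k\to\mathbb{R}$ be the empirical KLIEP loss $$\ell_{\mathrm{KL}}(\boldsymbol{\Delta})=-\boldsymbol{\Delta}^{\top}\bar{\boldsymbol{t}}^x+\log\left(\frac{1}{n_y}\sum_{j=1}^{n_y}\exp\{\boldsymbol{\Delta}^{\top}\mathbf{t}(\boldsymbol{Y}_j)\}\right).$$ Then: (i) $\bar{\boldsymbol{t}}^x\in\operatorname{relint}(\boldsymbol{C}^y)$ if and only if $\ell_{\mathrm{KL}}$ achieves a global minimum; (ii) $\bar{\boldsymbol{t}}^x\in\operatorname{relbd}(\boldsymbol{C}^y)$ if and only if $\ell_{\mathrm{KL}}$ is bounded from below but does not attain a global minimum; (iii) $\bar{\boldsymbol{t}}^x\notin\boldsymbol{C}^y$ if and only if $\ell_{\mathrm{KL}}$ is unbounded from below.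
   Context: The samples consist of $n_x\ge 1$ and $n_y\ge 1$ data points, treated as fixed (the result is deterministic, for given data). The map $\mathbf{t}=(t_1,\dots,t_k)^\top$ is the $k$-dimensional sufficient statistic of an exponential family with densities $f(\boldsymbol{x};\boldsymbol{\theta})=Z(\boldsymbol{\theta})^{-1}\exp\{\sum_{v=1}^k\theta_v t_v(\boldsymbol{x})\}$; the loss depends on the data only through the vector $\bar{\boldsymbol{t}}^x\in\mathbb{R}^k$ and the vectors $\mathbf{t}(\boldsymbol{Y}_j)\in\mathbb{R}^k$. For a convex set $S\subseteq\mathbb{R}^k$, $\operatorname{relint}(S)$ denotes its relative interior (interior relative to its affine hull) and $\operatorname{relbd}(S)$ its relative boundary; for the compact polytope $\boldsymbol{C}^y$, $\operatorname{relbd}(\boldsymbol{C}^y)=\boldsymbol{C}^y\setminus\operatorname{relint}(\boldsymbol{C}^y)$. $\operatorname{conv}$ denotes the convex hull. *)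

(* Defs.v *)
From HB Require Import structures.
From mathcomp Require Export all_boot all_order all_algebra.
From mathcomp Require Export all_classical all_reals all_analysis.
Export Order.TTheory GRing.Theory Num.Theory.
Export numFieldNormedType.Exports.

Set Implicit Arguments.
Unset Strict Implicit.
Unset Printing Implicit Defensive.

Local Open Scope classical_set_scope.
Local Open Scope ring_scope.

Definition convex_hull (R : realType) (k : nat) (A : set 'cV[R]_k) :
  set 'cV[R]_k := smallest (@convex_set R 'cV[R]_k) A.

Definition affine_set (R : realType) (k : nat) (A : set 'cV[R]_k) : Prop :=
  forall (x y : 'cV[R]_k) (a : R), A x -> A y -> A (a *: x + (1 - a) *: y).

Definition affine_hull (R : realType) (k : nat) (A : set 'cV[R]_k) :
  set 'cV[R]_k := smallest (@affine_set R k) A.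

(* [interior] is taken in the subspace topology of the affine hull. In the
   library's [subspace B] the points outside [B] are isolated; this is harmless
   here because the set is contained in its affine hull. *)
Definition relint (R : realType) (k : nat) (S : set 'cV[R]_k) :
  set 'cV[R]_k := @interior (subspace (affine_hull S)) S.

(* Affine subspaces of R^k are closed, so the closure relative to the affine
   hull is the closure in R^k. *)
Definition relbd (R : realType) (k : nat) (S : set 'cV[R]_k) :
  set 'cV[R]_k := closure S `\` relint S.

Definition dotc (R : realType) (k : nat) (u v : 'cV[R]_k) : R :=
  (u^T *m v) 0 0.

Definition mean_stat (R : realType) (k n : nat) (T : Type)
    (t : T -> 'cV[R]_k) (X : 'I_n -> T) : 'cV[R]_k :=
  n%:R^-1 *: \sum_(i < n) t (X i).

Definition kliep_loss (R : realType) (k nx ny : nat) (T : Type)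
    (t : T -> 'cV[R]_k) (X : 'I_nx -> T) (Y : 'I_ny -> T)
    (Delta : 'cV[R]_k) : R :=
  - dotc Delta (mean_stat t X)
  + ln (ny%:R^-1 * \sum_(j < ny) expR (dotc Delta (t (Y j)))).

Definition attains_min (R : realType) (E : Type) (f : E -> R) : Prop :=
  exists x0 : E, forall x : E, f x0 <= f x.

Definition bounded_below (R : realType) (E : Type) (f : E -> R) : Prop :=
  has_lbound (range f).

(* Main.v *)
Require Import Defs.
From mathcomp Require Import ring lra.

Set Implicit Arguments.
Unset Strict Implicit.
Unset Printing Implicit Defensive.

Local Open Scope classical_set_scope.
Local Open Scope ring_scope.

(** Write [y_j] for the [n] points [t (Y j)], [x] for the mean of the [t (X i)]
    and [p_j = y_j - x]. The loss at [D] is [ln (1/n * \sum_j exp (D . p_j))]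
    ([kliep_lossE]), so it has the same minimizers as the sum of exponentials
    [exp_sum p], and everything depends on the position of the origin relative
    to the polytope spanned by the [p_j].

    Boundedness. If [x] lies in the polytope, then for each direction [D] some
    [y_j] satisfies [D . x <= D . y_j], so one exponential is at least [1] and
    the loss is at least [- ln n]. If [x] does not lie in the polytope, a
    direction [D] in which all [D . p_j] are negative exists ([gordan]: take the
    opposite of the point of least norm in the polytope of the [p_j]), and the
    loss tends to minus infinity along it. This is
    [bounded_below_log_mean_exp].

    Attainment. At a minimizer the gradient of [exp_sum p] vanishes
    ([exp_sum_critical]), which writes [0] as a combination of the [p_j] with
    positive coefficients. The coefficients of a point of the affine hull close
    to [x] can be taken close to these, hence positive, so [x] is a relative
    interior point ([relint_of_positive_relation]). Conversely, if [x] is a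
    relative interior point, then for some [e > 0] all the points [x - e p_j]
    lie in the polytope ([relint_extend]). An upper bound on the numbers
    [D . p_j], such as the one that holds on the sublevel set of [exp_sum p]
    at [D = 0], then yields a lower bound on all of them. The vector
    [(D . p_j)_j] thus ranges over a compact part of a linear subspace, where
    the sum of exponentials attains its minimum
    ([attains_min_of_bounded_levels]).

    The statement on the relative boundary follows from these two because the
    polytope is closed, being an intersection of closed half-spaces
    ([polytope_halfspacesP]). *)

(** * The dot product and continuity of linear maps *)

Section DotProduct.
Variables (R : realType) (k : nat).
Implicit Types u v w : 'cV[R]_k.

Lemma dotcE u v : dotc u v = \sum_i u i 0 * v i 0.
Proof. by rewrite /dotc mxE; apply: eq_bigr => i _; rewrite mxE. Qed.

Lemma dotcC u v : dotc u v = dotc v u.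
Proof. by rewrite !dotcE; apply: eq_bigr => i _; rewrite mulrC. Qed.

Lemma dotcDr u v w : dotc u (v + w) = dotc u v + dotc u w.
Proof. by rewrite /dotc mulmxDr mxE. Qed.

Lemma dotcZr a u v : dotc u (a *: v) = a * dotc u v.
Proof. by rewrite /dotc -scalemxAr mxE. Qed.

Lemma dotcBr u v w : dotc u (v - w) = dotc u v - dotc u w.
Proof. by rewrite dotcDr -scaleN1r dotcZr mulN1r. Qed.

Lemma dotcDl u v w : dotc (u + v) w = dotc u w + dotc v w.
Proof. by rewrite dotcC dotcDr !(dotcC w). Qed.

Lemma dotcZl a u v : dotc (a *: u) v = a * dotc u v.
Proof. by rewrite dotcC dotcZr dotcC. Qed.

Lemma dotc0l v : dotc 0 v = 0.
Proof. by rewrite -(scale0r (0 : 'cV[R]_k)) dotcZl mul0r. Qed.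

Lemma dotc_sumr n u (f : 'I_n -> 'cV[R]_k) :
  dotc u (\sum_i f i) = \sum_i dotc u (f i).
Proof. by rewrite /dotc mulmx_sumr summxE. Qed.

Lemma dotcvv_ge0 v : 0 <= dotc v v.
Proof. by rewrite dotcE sumr_ge0// => i _; rewrite -expr2 sqr_ge0. Qed.

Lemma dotcvv_eq0 v : dotc v v = 0 -> v = 0.
Proof.
rewrite dotcE => /eqP; rewrite psumr_eq0; last first.
  by move=> i _; rewrite -expr2 sqr_ge0.
move=> /allP v0; apply/matrixP => i j; rewrite ord1 mxE; apply/eqP.
by have := v0 i (mem_index_enum i); rewrite mulf_eq0 orbb.
Qed.

End DotProduct.

Section Continuity.
Variable R : realType.

Lemma continuous_sum (T : topologicalType) n (f : 'I_n -> T -> R) :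
  (forall i, continuous (f i)) -> continuous (fun x => \sum_i f i x).
Proof.
elim: n f => [|n IH] f cf x.
  have -> : (fun x => \sum_i f i x) = cst 0.
    by apply/funext => y; rewrite big_ord0.
  exact: cst_continuous.
have -> : (fun x => \sum_i f i x)
    = (fun x => f ord0 x + \sum_i f (lift ord0 i) x).
  by apply/funext => y; rewrite big_ord_recl.
by apply: continuousD; [exact: cf|apply: IH => i; exact: cf].
Qed.

Lemma continuous_dotc k (D : 'cV[R]_k) : continuous (dotc D).
Proof.
have -> : dotc D = (fun x => \sum_i D i 0 * x i 0).
  by apply/funext => x; rewrite dotcE.
apply: continuous_sum => i x.
by apply: continuousM; [exact: cst_continuous|exact: coord_continuous].
Qed.

Lemma continuous_mulmx_coord m n (A : 'M[R]_(m, n)) j :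
  continuous (fun v : 'rV[R]_m => (v *m A) 0 j).
Proof.
have -> : (fun v : 'rV[R]_m => (v *m A) 0 j)
    = (fun v => \sum_i v 0 i * A i j).
  by apply/funext => x; rewrite mxE.
apply: continuous_sum => i x.
by apply: continuousM; [exact: coord_continuous|exact: cst_continuous].
Qed.

End Continuity.

(** * Convex hulls and separation from a polytope *)

Section ConvexHull.
Variables (R : realType) (k : nat).
Implicit Types (D x : 'cV[R]_k) (A : set 'cV[R]_k).

(** [convex_set] with coefficients in [R] instead of the type [{i01 R}]. *)
Lemma convex_setP A : @convex_set R 'cV[R]_k A <->
  forall x y (a : R), 0 <= a <= 1 -> A x -> A y -> A (a *: x + (1 - a) *: y).
Proof.
split=> [cA x y a a01 Ax Ay|cA x y l /set_mem Ax /set_mem Ay].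
  have [a0 a1] := andP a01.
  pose l : {i01 R} := Itv01 a0 a1.
  by have /set_mem := cA x y l (mem_set Ax) (mem_set Ay).
by apply/mem_set; apply: cA => //; rewrite ge0 le1.
Qed.

Lemma convex_hull_convex A x y (a : R) : 0 <= a <= 1 ->
  convex_hull A x -> convex_hull A y -> convex_hull A (a *: x + (1 - a) *: y).
Proof.
move=> a01 Ax Ay B [cB AB].
by move/convex_setP : (cB); apply => //; [exact: Ax|exact: Ay].
Qed.

Lemma convex_hull_sum A n (p : 'I_n -> 'cV[R]_k) (w : 'I_n -> R) :
  (forall j, A (p j)) -> (forall j, 0 <= w j) -> \sum_j w j = 1 ->
  convex_hull A (\sum_j w j *: p j).
Proof.
move=> Ap w0 w1.
(* Induction on the list of points: the points already summed have been merged
   into the single point [y] of the hull, which carries their total weight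
   [a]. *)
have key (s : seq 'I_n) (y : 'cV[R]_k) (a : R) : convex_hull A y -> 0 <= a ->
    a + \sum_(j <- s) w j = 1 ->
    convex_hull A (a *: y + \sum_(j <- s) w j *: p j).
  elim: s y a => [|i s IH] y a Ay a0.
    by rewrite !big_nil !addr0 => ->; rewrite scale1r.
  rewrite !big_cons !addrA => aw.
  have [b0|b0] := eqVneq (a + w i) 0.
    have wi0 := w0 i.
    have ea : a = 0 by lra.
    have ew : w i = 0 by lra.
    rewrite ea ew !scale0r !add0r.
    by have := IH y 0 Ay (lexx _); rewrite scale0r !add0r; apply; lra.
  have bp : 0 < a + w i by rewrite lt_neqAle eq_sym b0 addr_ge0.
  pose z := (a / (a + w i)) *: y + (1 - a / (a + w i)) *: p i.
  have -> : a *: y + w i *: p i = (a + w i) *: z.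
    by rewrite scalerDr !scalerA; congr (_ *: _ + _ *: _); field.
  apply: IH => //; last exact: ltW.
  apply: convex_hull_convex => //; last exact: sub_gen_smallest.
  by rewrite divr_ge0 ?(ltW bp)//= ler_pdivrMr// mul1r lerDl.
case: n p w Ap w0 w1 key => [|n] p w Ap w0 w1 key.
  by move: w1; rewrite big_ord0 => /esym/eqP; rewrite oner_eq0.
have := key (index_enum _) (p ord0) 0; rewrite scale0r !add0r; apply => //.
exact: sub_gen_smallest.
Qed.

Lemma convex_hull_le A D (c : R) x :
  (forall y, A y -> dotc D y <= c) -> convex_hull A x -> dotc D x <= c.
Proof.
move=> Ac; apply: (@smallest_sub _ _ A [set y | dotc D y <= c]) => //.
apply/convex_setP => y z a /andP[a0 a1] /= yc zc.
by rewrite dotcDr !dotcZr; nra.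
Qed.

(** A theorem of the alternative: either the origin is a convex combination of
    the points [p j], or it is strictly separated from all of them. The
    separating direction is the opposite of the point of least norm among the
    convex combinations, the weights of which range over a compact simplex. *)
Lemma gordan n (p : 'I_n.+1 -> 'cV[R]_k) :
  (exists2 w : 'I_n.+1 -> R, (forall j, 0 <= w j) /\ \sum_j w j = 1 &
     \sum_j w j *: p j = 0) \/
  exists D, exists2 c : R, 0 < c & forall j, dotc D (p j) <= - c.
Proof.
pose q (v : 'rV[R]_n.+1) := \sum_j v 0 j *: p j.
pose S := [set v : 'rV[R]_n.+1 | forall j, v 0 j \in `[0, 1]]
          `&` [set v | \sum_j v 0 j = 1].
have cS : compact S.
  apply: compact_closedI.
    have /= := @rV_compact R n.+1 (fun=> `[0, 1]%classic); apply => _.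
    exact: segment_compact.
  apply: (@closed_comp _ _ (fun v : 'rV[R]_n.+1 => \sum_j v 0 j) [set 1]).
    by move=> v _; apply: continuous_sum => j; exact: coord_continuous.
  exact: closed_eq.
have S0 : S !=set0.
  exists (delta_mx 0 0); split=> [j|] /=.
    by rewrite mxE; case: (_ && _); rewrite in_itv /= ?ler01 ?lexx.
  rewrite (bigD1 ord0)//= big1 ?mxE ?eqxx ?addr0// => j j0.
  by rewrite mxE (negbTE j0) andbF.
have cf : {within S, continuous (fun v => dotc (q v) (q v))}.
  apply: continuous_subspaceT.
  have -> : (fun v => dotc (q v) (q v)) = (fun v =>
      \sum_i (\sum_j v 0 j * p j i 0) * (\sum_j v 0 j * p j i 0)).
    apply/funext => v; rewrite dotcE; apply: eq_bigr => i _.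
    by rewrite /q !summxE; congr (_ * _); apply: eq_bigr => j _; rewrite mxE.
  have cq i : continuous (fun v : 'rV[R]_n.+1 => \sum_j v 0 j * p j i 0).
    apply: continuous_sum => j v.
    by apply: continuousM; [exact: coord_continuous|exact: cst_continuous].
  by apply: continuous_sum => i v; apply: continuousM; exact: cq.
have [v /set_mem[/= v01 v1] vmin] := EVT_min_rV S0 cS cf.
have [q0|q0] := eqVneq (q v) 0.
  left; exists (v 0) => //; split=> // j.
  by have := v01 j; rewrite in_itv => /andP[].
right; exists (- q v); exists (dotc (q v) (q v)).
  rewrite lt_neqAle dotcvv_ge0 andbT eq_sym.
  by apply: contra q0 => /eqP/dotcvv_eq0/eqP.
move=> j; rewrite -scaleN1r dotcZl mulN1r lerN2 -subr_ge0 -dotcBr leNgt.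
apply/negP => a0.
(* The segment from [q v] to [p j] consists of points of the polytope, so the
   square norm has a nonnegative slope along it at [q v]; otherwise the choice
   of [s] below gives a point of smaller norm. *)
set a := dotc (q v) (p j - q v) in a0.
set b := dotc (p j - q v) (p j - q v).
have b0 : 0 <= b by exact: dotcvv_ge0.
have ba : 0 < b - a by lra.
pose s := - a / (b - a).
have s0 : 0 < s by rewrite divr_gt0// oppr_gt0.
have s1 : s <= 1 by rewrite ler_pdivrMr// mul1r; lra.
have sE : s * (b - a) = - a by rewrite /s divfK// gt_eqF.
clearbody s.
pose u := v + s *: (delta_mx 0 j - v).
have uE i : u 0 i = (1 - s) * v 0 i + s * (i == j)%:R.
  by rewrite !mxE eqxx /=; ring.
have uS : S u.
  split=> /= [i|].
    have := v01 i; rewrite !in_itv /= uE => /andP[? ?].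
    by case: (i == j); rewrite ?mulr1 ?mulr0; apply/andP; split; nra.
  under eq_bigr do rewrite uE.
  rewrite big_split /= -!mulr_sumr v1 (bigD1 j)//= big1 ?eqxx; last first.
    by move=> i /negbTE ->.
  by rewrite /=; ring.
have qu : q u = q v + s *: (p j - q v).
  have pj : \sum_i (i == j)%:R *: p i = p j.
    rewrite (bigD1 j)//= big1 ?eqxx ?scale1r ?addr0// => i /negbTE ->.
    by rewrite scale0r.
  rewrite /q; under eq_bigr do rewrite uE scalerDl -!scalerA.
  rewrite big_split /= -!scaler_sumr pj scalerBl scale1r scalerBr.
  by rewrite -addrA; congr (_ + _); rewrite addrC.
have := vmin u (mem_set uS).
rewrite qu dotcDl !dotcDr !dotcZl !dotcZr (dotcC (p j - q v) (q v)) -/a -/b.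
by nra.
Qed.

End ConvexHull.

(** * Half-spaces, and lower bounds of the loss *)

Section Polytope.
Variables (R : realType) (k n : nat).
Implicit Types (y : 'I_n.+1 -> 'cV[R]_k) (x D : 'cV[R]_k).

(** A polytope is the intersection of the closed half-spaces that contain its
    generators. *)
Lemma polytope_halfspacesP y x : convex_hull (range y) x <->
  forall D c, (forall j, dotc D (y j) <= c) -> dotc D x <= c.
Proof.
split=> [yx D c yc|xD].
  by apply: convex_hull_le yx => _ [j _ <-].
have [[w [w0 w1] wx]|[D [c c0 Dc]]] := gordan (fun j => y j - x).
  have xE : x = \sum_j w j *: y j.
    apply/esym/subr0_eq; rewrite -[RHS]wx.
    under [RHS]eq_bigr do rewrite scalerBr.
    by rewrite sumrB -scaler_suml w1 scale1r.
  by rewrite xE; apply: convex_hull_sum => // j; exists j.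
have xc : dotc D x <= dotc D x - c.
  by apply: xD => j; have := Dc j; rewrite dotcBr; lra.
by move: xc c0; lra.
Qed.

Lemma closed_polytope y : closed (convex_hull (range y)).
Proof.
move=> x clx; apply/polytope_halfspacesP => D c yc.
have cl : closed (dotc D @^-1` [set r | r <= c]).
  apply: closed_comp; last exact: closed_le.
  by move=> z _; exact: continuous_dotc.
apply: cl; apply: closureS clx => z yz /=.
by move/polytope_halfspacesP : yz; exact.
Qed.

(** The sum of the exponentials of the [D . p_j]. *)
Definition exp_sum (p : 'I_n.+1 -> 'cV[R]_k) D : R :=
  \sum_j expR (dotc D (p j)).

Implicit Types p : 'I_n.+1 -> 'cV[R]_k.

Lemma exp_sum_gt0 p D : 0 < exp_sum p D.
Proof.
rewrite /exp_sum (bigD1 ord0)//= ltr_pwDl ?expR_gt0//.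
by apply: sumr_ge0 => j _; exact: expR_ge0.
Qed.

Lemma expR_le_exp_sum p D j : expR (dotc D (p j)) <= exp_sum p D.
Proof.
rewrite /exp_sum (bigD1 j)//= lerDl.
by apply: sumr_ge0 => i _; exact: expR_ge0.
Qed.

Lemma exp_sum0 p : exp_sum p 0 = n.+1%:R.
Proof.
rewrite /exp_sum; under eq_bigr do rewrite dotc0l expR0.
by rewrite sumr_const card_ord.
Qed.

(** The logarithm of the mean of the exponentials of the [D . p_j]. The loss is
    of this form, with the [p_j] the points of the second sample recentred at
    the mean of the first one. *)
Definition log_mean_exp p D : R := ln (n.+1%:R^-1 * exp_sum p D).

Lemma log_mean_exp_le p D D' :
  (log_mean_exp p D <= log_mean_exp p D') = (exp_sum p D <= exp_sum p D').
Proof.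
by rewrite ler_ln ?posrE ?mulr_gt0 ?invr_gt0 ?ltr0n ?exp_sum_gt0//
  ler_pM2l// invr_gt0 ltr0n.
Qed.

Lemma attains_min_log_mean_exp p :
  attains_min (log_mean_exp p) <-> attains_min (exp_sum p).
Proof.
by split=> -[D0 min]; exists D0 => D; have := min D; rewrite log_mean_exp_le.
Qed.

Lemma bounded_below_log_mean_exp y x :
  bounded_below (log_mean_exp (fun j => y j - x)) <-> convex_hull (range y) x.
Proof.
have n0 : 0 < n.+1%:R^-1 :> R by rewrite invr_gt0 ltr0n.
split=> [[b bP]|yx].
  apply/polytope_halfspacesP => D c yc; rewrite leNgt; apply/negP => cx.
  pose d := dotc D x - c.
  have d0 : 0 < d by rewrite subr_gt0.
  (* All [D . p_j] are at most [- d], so the value at [s *: D] is at most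
     [- s * d]; this [s] makes it [- `|b| - 1], which is below [b]. *)
  pose s := (`|b| + 1) / d.
  have s0 : 0 < s by rewrite divr_gt0// ltr_wpDl.
  have : b <= log_mean_exp (fun j => y j - x) (s *: D).
    by apply: bP; exists (s *: D).
  apply/negP; rewrite -ltNge.
  have sd : s * d = `|b| + 1 by rewrite /s divfK// gt_eqF.
  apply: (@le_lt_trans _ _ (- (s * d))); last first.
    by rewrite sd ltrNl; have := ler_norm (- b); rewrite normrN; lra.
  rewrite -[leRHS]expRK ler_ln ?posrE ?expR_gt0 ?mulr_gt0 ?exp_sum_gt0//.
  rewrite ler_pdivrMl ?ltr0n// mulr_natl -{2}(card_ord n.+1) -sumr_const.
  apply: ler_sum => j _; rewrite ler_expR dotcZl -mulrN ler_pM2l//.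
  by rewrite dotcBr; have := yc j; rewrite /d; lra.
exists (ln n.+1%:R^-1) => _ [D _ <-].
rewrite ler_ln ?posrE ?mulr_gt0 ?exp_sum_gt0// ler_peMr ?(ltW n0)//.
have [j jx] : exists j, dotc D x <= dotc D (y j).
  pose j0 := [arg max_(j > ord0) dotc D (y j)]%O.
  exists j0; move/polytope_halfspacesP : yx; apply => j.
  by rewrite /j0; case: arg_maxP => // i _; apply.
apply: le_trans (expR_le_exp_sum _ D j).
by rewrite -expR0 ler_expR dotcBr subr_ge0.
Qed.

(** * Existence and criticality of minimizers *)

(** If [exp_sum p D <= exp_sum p 0 = n.+1], each [D . p_j] is at most
    [ln n.+1]. When this forces a common lower bound too, a minimizer of
    [exp_sum p] exists: minimize over the vectors [(D . p_j)_j], which form the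
    row space of a matrix, cut down to a compact box. *)
Lemma attains_min_of_bounded_levels p (B : R) :
  (forall D, (forall j, dotc D (p j) <= ln n.+1%:R) ->
     forall j, - B <= dotc D (p j)) ->
  attains_min (exp_sum p).
Proof.
move=> Bp.
have ln0 : 0 <= ln n.+1%:R :> R by rewrite ln_ge0// ler1n.
pose M : 'M[R]_(k, n.+1) := \matrix_(i, j) p j i 0.
have dotM D j : (D^T *m M) 0 j = dotc D (p j).
  by rewrite dotcE mxE; apply: eq_bigr => i _; rewrite !mxE.
pose K := [set v : 'rV[R]_n.+1 | forall j, v 0 j \in `[- B, ln n.+1%:R]].
pose V := [set v : 'rV[R]_n.+1 | (v <= M)%MS].
have cV : closed V.
  (* A row space is the kernel of a cokernel, hence closed. *)
  have -> : V = \bigcap_j [set v : 'rV[R]_n.+1 | (v *m cokermx M) 0 j = 0].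
    apply/seteqP; split=> v /=; rewrite /V /= submxE.
      by move=> /eqP vM j _ /=; rewrite vM mxE.
    by move=> vM; apply/eqP/rowP => j; rewrite [RHS]mxE; exact: (vM j I).
  apply: closed_bigI => j _.
  apply: (@closed_comp _ _ (fun v : 'rV[R]_n.+1 => (v *m cokermx M) 0 j)
    [set 0]).
    by move=> v _; exact: continuous_mulmx_coord.
  exact: closed_eq.
have cKV : compact (K `&` V).
  apply: compact_closedI => //.
  have /= := @rV_compact R n.+1 (fun=> `[- B, ln n.+1%:R]%classic).
  by apply => _; exact: segment_compact.
have KV0 : (K `&` V) 0.
  split=> [j|]; last exact: sub0mx.
  rewrite mxE in_itv /= ln0 andbT.
  by rewrite -(dotc0l (p j)) Bp// => i; rewrite dotc0l.
pose G (v : 'rV[R]_n.+1) := \sum_j expR (v 0 j).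
have cG : {within K `&` V, continuous G}.
  apply: continuous_subspaceT; apply: continuous_sum => j v.
  apply: (@continuous_comp _ _ _ (fun v : 'rV[R]_n.+1 => v 0 j) expR).
    exact: coord_continuous.
  exact: continuous_expR.
have [c /set_mem[_ /submxP[u cu]] cmin] :=
  EVT_min_rV (ex_intro _ 0 KV0) cKV cG.
have GE D : G (D^T *m M) = exp_sum p D.
  by apply: eq_bigr => j _; rewrite dotM.
exists u^T => D; rewrite -GE trmxK -cu.
have [Dn|/ltW Dn] := leP (exp_sum p D) n.+1%:R; last first.
  apply: le_trans Dn; rewrite -(exp_sum0 p) -GE trmx0 mul0mx.
  by apply: cmin; exact: mem_set.
rewrite -GE; apply: cmin; apply: mem_set; split; last exact: submxMl.
have Dln j : dotc D (p j) <= ln n.+1%:R.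
  rewrite -ler_expR lnK ?posrE ?ltr0n//.
  exact: le_trans (expR_le_exp_sum p D j) Dn.
by move=> j; rewrite dotM in_itv /= Dln Bp.
Qed.

(** The sum below is the gradient of [exp_sum p] at [D0]. It is shown to vanish
    by differentiating along its own direction, where the derivative is its
    square norm. *)
Lemma exp_sum_critical p D0 : (forall D, exp_sum p D0 <= exp_sum p D) ->
  \sum_j expR (dotc D0 (p j)) *: p j = 0.
Proof.
move=> D0min; set q := \sum_j _; apply: dotcvv_eq0.
pose h (j : 'I_n.+1) (s : R) : R := expR (dotc D0 (p j) + s * dotc q (p j)).
have hd (s : R) : is_derive s 1 (\sum_j h j)
    (\sum_j expR (dotc D0 (p j) + s * dotc q (p j)) * dotc q (p j)).
  apply: is_derive_sum => j.
  apply: is_derive_eq.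
  by rewrite /GRing.scale /=; ring.
have hE s : (\sum_j h j) s = exp_sum p (D0 + s *: q).
  rewrite fct_sumE; apply: eq_bigr => j _.
  by rewrite /h dotcDl dotcZl.
have d0 : is_derive (0 : R) 1 (\sum_j h j) 0.
  apply: (@derive1_at_min _ _ (-1) 1).
  - by lra.
  - by move=> s _; have := hd s; case.
  - by rewrite in_itv /= ltrN10 ltr01.
  - by move=> s _; rewrite !hE scale0r addr0; exact: D0min.
have e0 := @derive_val _ _ _ _ _ _ _ d0.
rewrite (@derive_val _ _ _ _ _ _ _ (hd 0)) in e0.
rewrite -[RHS]e0 {2}/q dotc_sumr; apply: eq_bigr => j _.
by rewrite mul0r addr0 dotcZr.
Qed.

End Polytope.

(** * Relative interior points and minimizers *)

Section RelativeInterior.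
Variables (R : realType) (k : nat).
Implicit Types (S : set 'cV[R]_k) (x z : 'cV[R]_k).

(** Relative interior points in terms of the neighbourhoods of the ambient space
    alone. *)
Lemma relintP S x :
  relint S x <-> S x /\ \forall z \near x, affine_hull S z -> S z.
Proof.
have rel : S x -> relint S x = \forall z \near x, affine_hull S z -> S z.
  move=> Sx; have ax : affine_hull S x by exact: sub_gen_smallest.
  by rewrite /relint /interior /= /nbhs /= -nbhs_subspace_in.
split=> [rx|[Sx]]; last by rewrite rel.
have Sx : S x by apply: (@interior_subset (subspace (affine_hull S))).
by split=> //; rewrite -rel.
Qed.

Lemma affine_hull_affine S x z (a : R) :
  affine_hull S x -> affine_hull S z -> affine_hull S (a *: x + (1 - a) *: z).
Proof.
by move=> Sx Sz B BP; case: (BP) => aB _; apply: aB; [exact: Sx|exact: Sz].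
Qed.

(** From a relative interior point, one can move a little away from each of
    finitely many points of the set without leaving it. *)
Lemma relint_extend S x n (y : 'I_n -> 'cV[R]_k) :
  relint S x -> (forall j, S (y j)) ->
  exists2 e : R, 0 < e & forall j, S (x - e *: (y j - x)).
Proof.
move=> /relintP[Sx nx] Sy.
have nS j : \forall s \near (0 : R), S (x - s *: (y j - x)).
  have cg : (fun s : R => x - s *: (y j - x)) @ (0 : R) --> x.
    rewrite -[X in _ --> X]subr0 -[X in x - X](scale0r (y j - x)).
    apply: cvgB; first exact: cvg_cst.
    by apply: cvgZr_tmp; exact: cvg_id.
  have : \forall s \near (0 : R), affine_hull S (x - s *: (y j - x)) ->
      S (x - s *: (y j - x)) by exact: (cg _ nx).
  apply: filterS => s; apply.
  (* Every point of the line through [x] and [y j] is in the affine hull. *)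
  have -> : x - s *: (y j - x) = (1 + s) *: x + (1 - (1 + s)) *: y j.
    by apply/matrixP => a b; rewrite !mxE; ring.
  by apply: affine_hull_affine; exact: sub_gen_smallest.
have /nbhs_ballP[e /= e0 eS] :
    \forall s \near (0 : R), forall j, S (x - s *: (y j - x)).
  exact: (@filter_forall _ _ (fun j s => S (x - s *: (y j - x)))
    (nbhs (0 : R)) _ nS).
exists (e / 2); first by rewrite divr_gt0.
by apply: eS; rewrite /ball /= sub0r normrN gtr0_norm ?divr_gt0//; lra.
Qed.

Variables (n : nat) (y : 'I_n.+1 -> 'cV[R]_k).

(** For any [x], the affine hull of the polytope lies in [x] plus the span of the
    [y j - x]. *)
Lemma affine_hull_polytope_sub x z :
  affine_hull (convex_hull (range y)) z ->
  ((z - x)^T <= \matrix_j (y j - x)^T)%MS.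
Proof.
set M := \matrix_j _.
apply: (@smallest_sub _ _ _ [set z | ((z - x)^T <= M)%MS]).
  move=> u v a /= uM vM.
  have -> : a *: u + (1 - a) *: v - x = a *: (u - x) + (1 - a) *: (v - x).
    by apply/matrixP => b c; rewrite !mxE; ring.
  by rewrite linearD !linearZ /= addmx_sub// scalemx_sub.
apply: smallest_sub.
  apply/convex_setP => u v a _ /= uM vM.
  have -> : a *: u + (1 - a) *: v - x = a *: (u - x) + (1 - a) *: (v - x).
    by apply/matrixP => b c; rewrite !mxE; ring.
  by rewrite linearD !linearZ /= addmx_sub// scalemx_sub.
move=> _ [j _ <-] /=.
by rewrite -(rowK (fun j => (y j - x)^T) j) row_sub.
Qed.

(** A point from which the generators of a polytope satisfy a linear relation
    with positive coefficients is in the relative interior. *)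
Lemma relint_of_positive_relation x (w : 'I_n.+1 -> R) :
  (forall j, 0 < w j) -> \sum_j w j *: (y j - x) = 0 ->
  relint (convex_hull (range y)) x.
Proof.
move=> w0 wx.
set W := \sum_j w j.
have W0 : 0 < W.
  by rewrite /W (bigD1 ord0)//= ltr_pwDl ?sumr_ge0// => j _; exact: ltW.
pose M := \matrix_j (y j - x)^T.
(* On the affine hull, [mu z] is a vector of coordinates of [z - x] in the
   [y j - x], continuous in [z]. Adding a multiple of the relation [w] brings
   the total weight to [1] and does not change the point. *)
pose mu z : 'rV[R]_n.+1 := (z - x)^T *m pinvmx M.
pose c z j := mu z 0 j + (1 - \sum_i mu z 0 i) / W * w j.
have c1 z : \sum_j c z j = 1.
  rewrite big_split /= -mulr_sumr -/W divfK ?gt_eqF//.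
  by rewrite addrC subrK.
have cz z : ((z - x)^T <= M)%MS -> z = \sum_j c z j *: y j.
  move=> zM.
  have zx : z - x = \sum_j c z j *: (y j - x).
    under eq_bigr do rewrite scalerDl -scalerA.
    rewrite big_split /= -!scaler_sumr wx !scaler0 addr0.
    apply: trmx_inj; rewrite -[LHS](mulmxKpV zM) -/(mu z) mulmx_sum_row.
    by rewrite linear_sum /=; apply: eq_bigr => j _; rewrite rowK linearZ.
  rewrite -[LHS](subrK x) zx.
  under eq_bigr do rewrite scalerBr.
  by rewrite sumrB -scaler_suml c1 scale1r subrK.
have cont j : continuous
    (fun z => mu z 0 j + (1 - \sum_i mu z 0 i) / W * w j).
  have cmu i : continuous (fun z => mu z 0 i).
    have -> : (fun z => mu z 0 i)
        = (fun z => dotc (col i (pinvmx M)) z - dotc (col i (pinvmx M)) x).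
      apply/funext => z; rewrite -dotcBr dotcC dotcE mxE.
      by apply: eq_bigr => a _; rewrite !mxE.
    move=> z; apply: continuousB; last exact: cst_continuous.
    exact: continuous_dotc.
  move=> z; apply: (@continuousD _ _ _ (fun z => mu z 0 j)
    (fun z => (1 - \sum_i mu z 0 i) / W * w j) z); first exact: cmu.
  apply: continuousM; last exact: cst_continuous.
  apply: continuousM; last exact: cst_continuous.
  apply: continuousB; first exact: cst_continuous.
  exact: continuous_sum.
have cx j : c x j = w j / W.
  have mu0 i : mu x 0 i = 0 by rewrite /mu subrr trmx0 mul0mx mxE.
  by rewrite /c mu0 big1// subr0 mul1r add0r mulrC.
have hullc z : ((z - x)^T <= M)%MS -> (forall j, 0 < c z j) ->
    convex_hull (range y) z.
  move=> zM cpos; rewrite (cz z zM).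
  by apply: (@convex_hull_sum _ _ _ _ y (c z)) => [j|j|//];
    [exists j|exact: ltW].
have yx : convex_hull (range y) x.
  apply: hullc => [|j]; first by rewrite subrr trmx0 sub0mx.
  by rewrite cx divr_gt0.
apply/relintP; split=> //.
have : \forall z \near x, forall j, 0 < c z j.
  apply: (@filter_forall _ _ (fun j z => 0 < c z j) (nbhs x) _) => j.
  apply: (cvgr_gt (c x j)); first exact: cont.
  by rewrite cx divr_gt0.
apply: filterS => z cpos az.
by apply: hullc => //; exact: affine_hull_polytope_sub.
Qed.

(** A lower bound for [D . p_j] comes from comparing [x - e *: (y j - x)], a
    point of the polytope, with the generators. *)
Lemma attains_min_exp_sum x :
  attains_min (exp_sum (fun j => y j - x)) <-> relint (convex_hull (range y)) x.
Proof.
split=> [[D0 /exp_sum_critical]|rx].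
  by apply: relint_of_positive_relation => j; exact: expR_gt0.
have yy j : convex_hull (range y) (y j) by apply: sub_gen_smallest; exists j.
have [e e0 ey] := relint_extend rx yy.
apply: (@attains_min_of_bounded_levels _ _ _ _ (ln n.+1%:R / e)) => D Dn j.
rewrite -mulNr ler_pdivrMr//.
have eyD : dotc D (x - e *: (y j - x)) <= dotc D x + ln n.+1%:R.
  move/polytope_halfspacesP : (ey j); apply => i.
  by have := Dn i; rewrite dotcBr; lra.
by rewrite dotcBr dotcZr in eyD; lra.
Qed.

End RelativeInterior.

(** * The empirical loss *)

Lemma kliep_lossE (R : realType) (k nx n : nat) (T : Type)
    (t : T -> 'cV[R]_k) (X : 'I_nx -> T) (Y : 'I_n.+1 -> T) :
  kliep_loss t X Y = log_mean_exp (fun j => t (Y j) - mean_stat t X).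
Proof.
apply/funext => D; rewrite /kliep_loss /log_mean_exp /exp_sum.
under [in RHS]eq_bigr do rewrite dotcBr expRD.
have S0 := exp_sum_gt0 (fun j => t (Y j)) D.
rewrite -mulr_suml mulrA [RHS]lnM ?posrE ?expR_gt0 ?expRK 1?addrC//.
by rewrite mulr_gt0 ?invr_gt0 ?ltr0n.
Qed.

Theorem theorem1 (R : realType) (k nx ny : nat) (hnx : (0 < nx)%N)
    (hny : (0 < ny)%N) (T : Type) (t : T -> 'cV[R]_k)
    (X : 'I_nx -> T) (Y : 'I_ny -> T) :
  let tx : 'cV[R]_k := mean_stat t X in
  let Cy : set 'cV[R]_k := convex_hull [set t (Y j) | j in [set: 'I_ny]] in
  let loss : 'cV[R]_k -> R := kliep_loss t X Y in
  [/\ tx \in relint Cy <-> attains_min loss,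
      tx \in relbd Cy <-> bounded_below loss /\ ~ attains_min loss
    & tx \notin Cy <-> ~ bounded_below loss].
Proof.
case: ny hny Y => [//|n] _ Y tx Cy loss.
have min : relint Cy tx <-> attains_min loss.
  rewrite /loss kliep_lossE attains_min_log_mean_exp.
  by rewrite -(attains_min_exp_sum (fun j => t (Y j))).
have bnd : Cy tx <-> bounded_below loss.
  rewrite /loss kliep_lossE.
  apply: iff_sym.
  exact: (bounded_below_log_mean_exp (fun j => t (Y j)) tx).
have clE : closure Cy = Cy.
  have clCy : closed Cy := closed_polytope (y := fun j => t (Y j)).
  by rewrite -(closure_id _).1.
split; first by rewrite inE.
- by rewrite inE /relbd clE /setD /= min bnd.
- by rewrite notin_setE bnd.
Qed.
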